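(* Let $m_{a,b}\in S_{a+b+1}$, $(a,b)\in\mathbb{N}\times\mathbb{N}$, be elements satisfying: $m_{0,0}=D^5$; $T_7(m_{a,b})=m_{a-1,b}$ if $a>0$ and $T_7(m_{0,b})=0$; $T_{13}(m_{a,b})=m_{a,b-1}$ if $b>0$ and $T_{13}(m_{a,0})=0$. Then for each $r\ge0$ the $m_{a,b}$ with $a+b\le r$ are linearly independent over $\mathbb{Z}/2$ (and, there being $(r+1)(r+2)/2$ of them, they form a basis of $S_{r+1}$).
   Context: For an odd prime $p$, $T_p:\mathbb{Z}/2[[x]]\to\mathbb{Z}/2[[x]]$ is the map $\sum c_nx^n\mapsto\sum c_{pn}x^n+\sum c_nx^{pn}$. Let $D=\sum_{n>0,\ \gcd(n,6)=1}x^{n^2}\in\mathbb{Z}/2[[x]]$. Let $g:\mathbb{N}\to\mathbb{N}$ be the function with $g(0)=0$, $g(2n)=4g(n)$, $g(2n+1)=g(2n)+1$. For $a,b\in\mathbb{N}$ put $[a,b,G]=D^{5+6g(a)+12g(b)}$ (these are exactly the $D^n$ with $n>0$, $n\equiv 5\pmod 6$, each arising from a unique $(a,b)$). For $m\ge0$, $S_m$ is the $\mathbb{Z}/2$-span of the $[a,b,G]$ with $a+b<m$; it has dimension $m(m+1)/2$. *)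

(* Defs.v *)
From HB Require Import structures.
From mathcomp Require Import all_boot all_order all_algebra.
From mathcomp Require Import boolp.

Set Implicit Arguments.
Unset Strict Implicit.
Unset Printing Implicit Defensive.

Import GRing.Theory.
Local Open Scope ring_scope.

(* Formal power series over R, as sequences of coefficients: [f n] is the
   coefficient of x^n in [f]. *)
Record fps (R : Type) := FPS { fps_coef :> nat -> R }.

Lemma fps_coefK (R : Type) : cancel (@fps_coef R) (@FPS R).
Proof. by case. Qed.

Lemma fpsP (R : Type) (f g : fps R) : (forall n, f n = g n) <-> f = g.
Proof.
split=> [fg|-> //]; rewrite -(fps_coefK f) -(fps_coefK g).
by congr FPS; apply/funext.
Qed.

HB.instance Definition _ (R : Type) := gen_eqMixin (fps R).
HB.instance Definition _ (R : Type) := gen_choiceMixin (fps R).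

Section FpsRing.
Variable R : comNzRingType.
Implicit Types f g h : fps R.

Definition fps_zero : fps R := FPS (fun=> 0).
Definition fps_opp f : fps R := FPS (fun n => - f n).
Definition fps_add f g : fps R := FPS (fun n => f n + g n).
Definition fps_one : fps R := FPS (fun n => (n == 0%N)%:R).
Definition fps_mul f g : fps R :=
  FPS (fun n => \sum_(i < n.+1) f i * g (n - i)%N).
Definition fps_scale (a : R) f : fps R := FPS (fun n => a * f n).

Fact fps_addA : associative fps_add.
Proof. by move=> f g h; apply/fpsP => n /=; rewrite addrA. Qed.
Fact fps_addC : commutative fps_add.
Proof. by move=> f g; apply/fpsP => n /=; rewrite addrC. Qed.
Fact fps_add0 : left_id fps_zero fps_add.
Proof. by move=> f; apply/fpsP => n /=; rewrite add0r. Qed.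
Fact fps_addN : left_inverse fps_zero fps_opp fps_add.
Proof. by move=> f; apply/fpsP => n /=; rewrite addNr. Qed.

HB.instance Definition _ :=
  GRing.isZmodule.Build (fps R) fps_addA fps_addC fps_add0 fps_addN.

Let trunc N f : {poly R} := \poly_(i < N) f i.

Let mul_trunc N n f g : (n < N)%N -> fps_mul f g n = (trunc N f * trunc N g)`_n.
Proof.
move=> nN; rewrite coefM; apply: eq_bigr => -[i /= i_n] _.
by rewrite !coef_poly (leq_trans i_n nN) (leq_ltn_trans (leq_subr _ _) nN).
Qed.

Let coefM_ext (p p' q q' : {poly R}) n :
    (forall i, (i <= n)%N -> p`_i = p'`_i) ->
    (forall i, (i <= n)%N -> q`_i = q'`_i) ->
  (p * q)`_n = (p' * q')`_n.
Proof.
move=> ep eq; rewrite !coefM; apply: eq_bigr => -[i /= i_n] _.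
by rewrite ep // eq // leq_subr.
Qed.

Let trunc_mul N n f g : (n < N)%N ->
  (trunc N (fps_mul f g))`_n = (trunc N f * trunc N g)`_n.
Proof. by move=> nN; rewrite coef_poly nN (mul_trunc _ _ nN). Qed.

Fact fps_mulA : associative fps_mul.
Proof.
move=> f g h; apply/fpsP => n; rewrite !(mul_trunc _ _ (ltnSn n)).
rewrite (@coefM_ext _ (trunc n.+1 f) _ (trunc n.+1 g * trunc n.+1 h)) //.
  by rewrite mulrA; apply: coefM_ext => // i i_n; rewrite trunc_mul.
by move=> i i_n; rewrite trunc_mul.
Qed.

Fact fps_mulC : commutative fps_mul.
Proof.
by move=> f g; apply/fpsP => n; rewrite !(mul_trunc _ _ (ltnSn n)) mulrC.
Qed.

Fact fps_mul1 : left_id fps_one fps_mul.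
Proof.
move=> f; apply/fpsP => n /=; rewrite big_ord_recl /= mul1r subn0 big1 ?addr0//.
by move=> i _; rewrite mul0r.
Qed.

Fact fps_mulD : left_distributive fps_mul fps_add.
Proof.
move=> f g h; apply/fpsP => n /=; rewrite -big_split /=.
by apply: eq_bigr => i _; rewrite mulrDl.
Qed.

Fact fps_one_neq0 : fps_one != 0.
Proof.
apply/eqP => /(congr1 (fun f : fps R => f 0%N)) /= /eqP.
by rewrite (negbTE (oner_neq0 R)).
Qed.

HB.instance Definition _ := GRing.Zmodule_isComNzRing.Build (fps R)
  fps_mulA fps_mulC fps_mul1 fps_mulD fps_one_neq0.

Fact fps_scaleA a b f : fps_scale a (fps_scale b f) = fps_scale (a * b) f.
Proof. by apply/fpsP => n /=; rewrite mulrA. Qed.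
Fact fps_scale1 : left_id 1 fps_scale.
Proof. by move=> f; apply/fpsP => n /=; rewrite mul1r. Qed.
Fact fps_scaleDr : right_distributive fps_scale +%R.
Proof. by move=> a f g; apply/fpsP => n /=; rewrite mulrDr. Qed.
Fact fps_scaleDl f : {morph fps_scale^~ f : a b / a + b}.
Proof. by move=> a b; apply/fpsP => n /=; rewrite mulrDl. Qed.

HB.instance Definition _ := GRing.Zmodule_isLmodule.Build R (fps R)
  fps_scaleA fps_scale1 fps_scaleDr fps_scaleDl.

End FpsRing.

(* [fps R] is infinite dimensional, hence not a [vectType]; these are the usual
   notions for finite families in an arbitrary module. *)
Section FiniteFamilies.
Variables (R : nzRingType) (V : lmodType R) (I : finType).
Implicit Type v : I -> V.

Definition lin_indep v : Prop :=
  forall c : I -> R, \sum_i c i *: v i = 0 -> forall i, c i = 0.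

Definition in_span v (x : V) : Prop :=
  exists c : I -> R, x = \sum_i c i *: v i.

Definition is_basis_of (U : V -> Prop) v : Prop :=
  [/\ forall i, U (v i), lin_indep v & forall x, U x -> in_span v x].

End FiniteFamilies.

(* The pairs (a, b) of natural numbers with a + b < k. *)
Definition tri (k : nat) : finType :=
  {ab : 'I_k * 'I_k | (ab.1 + ab.2 < k)%N}.

Definition tri_family (T : Type) (u : nat -> nat -> T) (k : nat) : tri k -> T :=
  fun ab => u (val ab).1 (val ab).2.
Arguments tri_family {T} u k _ /.

Definition hecke (p : nat) (f : fps 'F_2) : fps 'F_2 :=
  FPS (fun n => f (p * n)%N + (if (p %| n)%N then f (n %/ p)%N else 0)).

(* A k with k ^ 2 = n satisfies k <= n. *)
Definition D : fps 'F_2 :=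
  FPS (fun n => \sum_(k < n.+1 | (0 < k)%N && (gcdn k 6 == 1%N))
                  ((k ^ 2)%N == n)%:R).

(* Recursion on the binary digits of n; the fuel n suffices. *)
Fixpoint g_rec (fuel n : nat) : nat :=
  if fuel is fuel'.+1 then (4 * g_rec fuel' n./2 + odd n)%N else 0%N.
Definition g (n : nat) : nat := g_rec n n.

Lemma g_rec_fuel k n : (n <= k)%N -> g_rec k n = g n.
Proof.
rewrite /g; elim/ltn_ind: n k => -[|n] IH k.
  by move=> _; elim: k => //= k ->.
case: k => // k; rewrite ltnS => n_k /=.
have half_n : (uphalf n <= n)%N by rewrite leq_uphalf_double -addnn leq_addr.
by rewrite !IH // (leq_trans half_n).
Qed.

Lemma g0 : g 0 = 0%N. Proof. by []. Qed.

Lemma g_half n : g n = (4 * g n./2 + odd n)%N.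
Proof.
case: n => // n; rewrite {1}/g /= g_rec_fuel //.
by rewrite leq_uphalf_double -addnn leq_addr.
Qed.

Lemma g_even n : g (2 * n) = (4 * g n)%N.
Proof. by rewrite g_half mul2n doubleK odd_double addn0. Qed.

Lemma g_odd n : g (2 * n + 1) = (g (2 * n) + 1)%N.
Proof.
by rewrite g_half g_even addn1 mul2n /= uphalf_double odd_double.
Qed.

(* [brG a b] is written [a, b, G]; [spanG k] is S_k. *)
Definition brG (a b : nat) : fps 'F_2 := D ^+ (5 + 6 * g a + 12 * g b).

Definition spanG (k : nat) : fps 'F_2 -> Prop := in_span (tri_family brG k).

(* Main.v *)
Require Import Defs.
From HB Require Import structures.
From mathcomp Require Import all_boot all_order all_algebra.
Import GRing.Theory.
Local Open Scope ring_scope.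

(** In a nontrivial relation among the [m a b], choose a term [m a b] that occurs
    in it with [a + b] maximal.  Applying [T_7] [a] times and [T_13] [b] times
    kills all the other terms and leaves [m 0 0 = D ^+ 5], which is nonzero
    because its coefficient of x^5 is 1.  The [m a b] with [a + b <= r] are
    thus independent, and they lie in the span of the equally many [brG a b]
    with [a + b <= r], so the transition matrix is invertible. *)

(** Both families have the same index type, so the coefficients of [v] in terms of [w] form a square
    matrix. A row vector in its left kernel is a linear relation among the [v i], hence zero, so the
    matrix is invertible. *)
Lemma in_span_of_lin_indep (F : fieldType) (V : lmodType F) (I : finType)
    (v w : I -> V) :
  lin_indep v -> (forall i, in_span w (v i)) ->
  forall x, in_span w x -> in_span v x.
Proof.
move=> v_free v_w _ [d ->]; have [A vE] := boolp.choice v_w.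
pose M : 'M[F]_#|I| := \matrix_(i, k) A (enum_val i) (enum_val k).
have sum_vE n (B : 'M_(n, #|I|)) l :
  \sum_i B l (enum_rank i) *: v i = \sum_k (B *m M) l (enum_rank k) *: w k.
  under eq_bigr do rewrite vE scaler_sumr.
  rewrite exchange_big; apply: eq_bigr => k _ /=.
  under eq_bigr do rewrite scalerA.
  rewrite -scaler_suml mxE; congr (_ *: _).
  rewrite (reindex _ (onW_bij _ (enum_val_bij _))).
  by apply: eq_bigr => i _; rewrite mxE enum_rankK enum_valK.
have M_unit : M \in unitmx.
  rewrite -row_free_unit -kermx_eq0; apply/rowV0P => u /sub_kermxP uM0.
  apply/rowP => i; rewrite mxE -[i]enum_valK.
  apply: (v_free (fun x => u 0 (enum_rank x))).
  by rewrite sum_vE uM0 big1 // => k _; rewrite mxE scale0r.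
(* Coordinates pass from [w] to [v] by right multiplication with the inverse of [M]. *)
exists (fun i => (\row_k d (enum_val k) *m invmx M) 0 (enum_rank i)).
rewrite sum_vE mulmxKV //; apply: eq_bigr => k _.
by rewrite mxE enum_rankK.
Qed.

Lemma in_span_comp (R : nzRingType) (V : lmodType R) (I J : finType)
    (w : J -> V) (h : I -> J) (x : V) :
  in_span (w \o h) x -> in_span w x.
Proof.
move=> [c ->]; exists (fun j => \sum_(i | h i == j) c i).
under [RHS]eq_bigr do rewrite scaler_suml.
rewrite (exchange_big_dep xpredT) //=; apply: eq_bigr => i _.
by rewrite (big_pred1 (h i)) // => j; rewrite eq_sym.
Qed.

Lemma spanG_leq k l x : (k <= l)%N -> spanG k x -> spanG l x.
Proof.
move=> k_l.
have tri_l (t : tri k) :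
  (widen_ord k_l (val t).1 + widen_ord k_l (val t).2 < l)%N.
  exact: leq_trans (valP t) k_l.
pose h (t : tri k) : tri l :=
  Sub (widen_ord k_l (val t).1, widen_ord k_l (val t).2) (tri_l t).
exact: (@in_span_comp _ _ _ _ (tri_family brG l) h).
Qed.

(** A first index [i] leaves [k - i] choices for the second; in reversed order these counts add up
    as 1 + ... + k. *)
Lemma card_tri k : #|tri k| = (k.+1 * k %/ 2)%N.
Proof.
rewrite card_sig -sum1_card.
rewrite -(pair_big_dep xpredT (fun i j : 'I_k => i + j < k)%N
  (fun _ _ => 1%N)) /=.
rewrite divn2 -(bin2 k.+1) -bin2_sum big_mkord big_ord_recl add0n.
rewrite [RHS](reindex_inj rev_ord_inj) /=; apply: eq_bigr => i _.
transitivity (\sum_(j < k - i) 1)%N.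
  rewrite (big_ord_widen k (fun=> 1%N)) ?leq_subr //.
  by apply: eq_bigl => j; rewrite ltn_subRL.
by rewrite sum1_card card_ord /bump /= add1n subnSK.
Qed.

(** A nonzero term [f i * h (n - i)] needs [s <= i] and [t <= n - i]. No [n] below [s + t] allows
    this, and for [n = s + t] only [i = s] does. *)
Lemma fps_coefM_low (R : comNzRingType) (f h : fps R) s t :
    (forall i, (i < s)%N -> f i = 0) -> (forall i, (i < t)%N -> h i = 0) ->
  (forall i, (i < s + t)%N -> (f * h) i = 0) /\ (f * h) (s + t)%N = f s * h t.
Proof.
move=> f0 h0; split=> [n n_st|].
  apply: big1 => i _; have [/f0->|s_i] := ltnP i s; first by rewrite mul0r.
  rewrite h0 ?mulr0 // ltn_subLR; last by rewrite -ltnS.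
  by rewrite (leq_trans n_st) // leq_add2r.
have s_st : (s < (s + t).+1)%N by rewrite ltnS leq_addr.
rewrite [LHS](bigD1 (Ordinal s_st)) //= addKn big1 ?addr0 // => i i_s.
have [/f0->|s_i] := ltnP i s; first by rewrite mul0r.
rewrite h0 ?mulr0 // ltn_subLR; last by rewrite -ltnS.
by rewrite ltn_add2r ltn_neqAle s_i andbT eq_sym.
Qed.

Lemma coef_D_exp n : (D ^+ n) n = 1.
Proof.
(* Since [D] starts with x, its power [D ^+ n] starts with x^n; the vanishing below [n] must be
   carried through the induction to control the leading coefficient. *)
suff: (forall i, (i < n)%N -> (D ^+ n) i = 0) /\ (D ^+ n) n = 1 by case.
elim: n => [|n [D0 D1]] //.
have d0 : forall i, (i < 1)%N -> D i = 0.
  by case=> // _ /=; rewrite big_mkcond big_ord1.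
have d1 : D 1%N = 1 by rewrite /= big_mkcond !big_ord_recl big_ord0 /= addr0 add0r.
have [] := fps_coefM_low _ _ _ _ _ d0 D0.
by rewrite -exprS add1n d1 D1 mulr1.
Qed.

Lemma hecke_is_linear p : linear (hecke p).
Proof.
move=> a f h; apply/fpsP => n /=.
by case: ifP => _; rewrite ?addr0 // mulrDr addrACA.
Qed.

HB.instance Definition _ p := GRing.isLinear.Build 'F_2 (fps 'F_2) (fps 'F_2) _
  (hecke p) (hecke_is_linear p).

Lemma iter_hecke_sum p n (I : finType) (c : I -> 'F_2) (v : I -> fps 'F_2) :
  iter n (hecke p) (\sum_i c i *: v i) = \sum_i c i *: iter n (hecke p) (v i).
Proof.
elim: n => //= n ->; rewrite linear_sum.
by apply: eq_bigr => i _; rewrite linearZ.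
Qed.

(** Only one index moves, so this serves [hecke 7] and [hecke 13] alike, the other index being
    fixed. Once the index has reached 0, the next application gives 0, and additivity keeps it
    there. *)
Lemma iter_shift (V : zmodType) (T : {additive V -> V}) (u : nat -> V) :
    T (u 0%N) = 0 -> (forall a, (0 < a)%N -> T (u a) = u (a - 1)%N) ->
  forall n a, iter n T (u a) = if (n <= a)%N then u (a - n)%N else 0.
Proof.
move=> T0 Tu; elim=> [|n IH] a /=; first by rewrite subn0.
rewrite IH; have [na|an|->] := ltngtP n a; last by rewrite subnn.
  by rewrite Tu ?subn_gt0 // -subnDA addn1.
exact: raddf0.
Qed.

Theorem theorem4p14 (m : nat -> nat -> fps 'F_2)
    (m_in_S : forall a b : nat, spanG (a + b + 1) (m a b))
    (m00 : m 0%N 0%N = D ^+ 5)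
    (T7_pos : forall a b : nat, (0 < a)%N -> hecke 7 (m a b) = m (a - 1)%N b)
    (T7_zero : forall b : nat, hecke 7 (m 0%N b) = 0)
    (T13_pos : forall a b : nat, (0 < b)%N -> hecke 13 (m a b) = m a (b - 1)%N)
    (T13_zero : forall a : nat, hecke 13 (m a 0%N) = 0)
    (r : nat) :
  [/\ lin_indep (tri_family m (r + 1)),
      #|tri (r + 1)| = (((r + 1) * (r + 2)) %/ 2)%N &
      is_basis_of (spanG (r + 1)) (tri_family m (r + 1))].
Proof.
have m_free : lin_indep (tri_family m (r + 1)).
  move=> c c_m i0; apply/eqP/negPn/negP => ci0.
  case: (@arg_maxnP _ i0 (fun i => c i != 0)
    (fun i => (val i).1 + (val i).2)%N ci0) => i ci i_max.
  (* [hecke 7] acts first and turns each [m a b] into another member of the family or 0, so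
     [hecke 13] can again be evaluated as a shift. *)
  move: (congr1 (iter (val i).2 (hecke 13) \o iter (val i).1 (hecke 7)) c_m).
  rewrite /= !iter_hecke_sum (bigD1 i) //=.
  have shift7 b := iter_shift _ (hecke 7) (m^~ b) (T7_zero b) (T7_pos^~ b).
  have shift13 a := iter_shift _ (hecke 13) (m a) (T13_zero a) (T13_pos a).
  have iter0 p n : iter n (hecke p) 0 = 0 by elim: n => //= n ->; exact: raddf0.
  rewrite shift7 leqnn subnn shift13 leqnn subnn m00 !iter0 big1 => [|j j_i].
    rewrite addr0 => /(congr1 (fun f : fps 'F_2 => f 5%N)).
    rewrite -[LHS]/(c i * (D ^+ 5) 5%N) -[RHS]/(0 : 'F_2).
    by rewrite coef_D_exp mulr1 => /eqP; rewrite (negbTE ci).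
  (* A term with smaller first index than [i] dies under [hecke 7], one with smaller second index
     under [hecke 13]. If neither index is smaller, the bound [ij] on their sum forces [j = i]. *)
  have [->|/i_max ij] := eqVneq (c j) 0; first by rewrite scale0r.
  rewrite shift7; case: leqP => [a_ij|_]; last by rewrite iter0 scaler0.
  rewrite shift13; case: leqP => [b_ij|_]; last by rewrite scaler0.
  case/eqP: j_i; apply/val_inj; rewrite [LHS]surjective_pairing.
  rewrite [RHS]surjective_pairing; congr pair; apply/val_inj/eqP.
    rewrite eqn_leq a_ij andbT -(leq_add2r (val i).2).
    by rewrite (leq_trans _ ij) // leq_add2l.
  rewrite eqn_leq b_ij andbT -(leq_add2l (val i).1).
  by rewrite (leq_trans _ ij) // leq_add2r.
have m_S (i : tri (r + 1)) : spanG (r + 1) (tri_family m (r + 1) i).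
  by apply: spanG_leq (m_in_S _ _); rewrite addn1; exact: valP i.
split=> //; first by rewrite card_tri mulnC addn1 addn2.
split=> //; exact: in_span_of_lin_indep m_free m_S.
Qed.
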